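(* Let $v,w\in S_n$, and let $y_1,\dots,y_n$ and $b_1,\dots,b_n$ be variables. The following are equivalent: (1) $w\le v$ in the Bruhat order on $S_n$. (2) $\mathfrak{S}_w(y_{v(1)},\dots,y_{v(n)}\,;\,y_1,\dots,y_n)\neq 0$. (3) $\mathfrak{G}_w(b_{v(1)},\dots,b_{v(n)}\,;\,b_1,\dots,b_n)\neq 0$.
   Context: $S_n$ is the symmetric group on $\{1,\dots,n\}$, products of permutations are compositions of maps ($(uv)(i)=u(v(i))$), $s_i$ is the transposition of $i$ and $i+1$, and $w_0$ is the longest element of $S_n$. In (2) and (3), ''$\neq 0$'' means nonzero as a (Laurent) polynomial in the variables. Double Schubert polynomials (Lascoux–Schützenberger). For $w\in S_n$, $\mathfrak{S}_w(x;y)=\mathfrak{S}_w(x_1,\dots,x_n;y_1,\dots,y_n)$ is the polynomial with integer coefficients determined by: $\mathfrak{S}_{w_0}(x;y)=\prod_{i+j\le n}(x_i-y_j)$, and $\mathfrak{S}_{ws_i}=\partial_i(\mathfrak{S}_w)$ whenever $w(i)>w(i+1)$, where $\partial_i(f)=\dfrac{f-f'}{x_i-x_{i+1}}$ and $f'$ is obtained from $f$ by interchanging $x_i$ and $x_{i+1}$. Double Grothendieck polynomials (Lascoux–Schützenberger). For $w\in S_n$, $\mathfrak{G}_w(a;b)=\mathfrak{G}_w(a_1,\dots,a_n;b_1,\dots,b_n)$ is the Laurent polynomial with integer coefficients (a polynomial in the $a_i^{-1}$ and $b_j$) determined by: $\mathfrak{G}_{w_0}(a;b)=\prod_{i+j\le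 n}(1-b_j/a_i)$, and $\mathfrak{G}_{ws_i}=\pi_i(\mathfrak{G}_w)$ whenever $w(i)>w(i+1)$, where $\pi_i(f)=\dfrac{a_i f-a_{i+1}\,f'}{a_i-a_{i+1}}$ and $f'$ is obtained from $f$ by interchanging $a_i$ and $a_{i+1}$. *)

(* Defs.v *)
From HB Require Import structures.
From mathcomp Require Import all_boot all_order all_fingroup all_algebra.
From mathcomp Require Import zify ring.
From mathcomp.multinomials Require Import mpoly.

Set Implicit Arguments.
Unset Strict Implicit.
Unset Printing Implicit Defensive.

Import GRing.Theory.
Local Open Scope ring_scope.

Notation "x %:F" := (FracField.tofrac x) : ring_scope.

(* The indices 1, ..., n are the elements 0, ..., n-1 of 'I_n.  Products in
   'S_n are read from left to right, (s * t) i = t (s i), so the permutation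
   u \o v, usually denoted by uv, is (v * u)%g; in particular w s_i is
   (tperm i j * w)%g with j = i + 1. *)

Section Bruhat.
Variable n : nat.
Implicit Types u v w : 'S_n.

Definition perm_length w : nat :=
  #|[set p : 'I_n * 'I_n | (p.1 < p.2)%N && (w p.2 < w p.1)%N]|.

(* from u to the product ut, for a transposition t increasing the length *)
Definition bruhat_step : rel 'S_n := fun u v =>
  (perm_length u < perm_length v)%N
  && [exists i, exists j, v == (tperm i j * u)%g].

Definition bruhat_le : rel 'S_n := connect bruhat_step.

Definition longest_perm : 'S_n := perm (@rev_ord_inj n).

End Bruhat.

Section Polynomials.
Variable n : nat.
Local Notation P := {mpoly int[n + n]}.
Implicit Types (f g : P) (i j : 'I_n).

(* Z[x; y], also used as Z[a; b] *)
Definition xvar i : P := 'X_(lshift n i).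
Definition yvar j : P := 'X_(rshift n j).

Definition swapx i j : P -> P := msym (tperm (lshift n i) (lshift n j)).

Definition eval2 (K : comNzRingType) (u v : 'I_n -> K) f : K :=
  mmap intr (fun c : 'I_(n + n) =>
    match split c with inl i => u i | inr j => v j end) f.

Definition divided_difference i j f : {fraction P} :=
  (f%:F - (swapx i j f)%:F) / ((xvar i)%:F - (xvar j)%:F).

Definition is_double_schubert (S : 'S_n -> P) : Prop :=
  S (longest_perm n) =
    \prod_(i < n) \prod_(j < n | (i.+1 + j.+1 <= n)%N) (xvar i - yvar j) /\
  forall (w : 'S_n) i j, j = i.+1 :> nat -> (w j < w i)%N ->
    (S (tperm i j * w)%g)%:F = divided_difference i j (S w).

(* A polynomial in the a_i^-1 and b_j is encoded by f : P in which xvar i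
   stands for a_i^-1; its value at (a; b) is laurent_eval a b f, and the
   Laurent polynomial itself is its value at the variables, in the field of
   fractions of Z[a; b]. *)
Definition laurent_eval (K : fieldType) (a b : 'I_n -> K) f : K :=
  eval2 (fun i => (a i)^-1) b f.

Definition laurent f : {fraction P} :=
  laurent_eval (fun i => (xvar i)%:F) (fun j => (yvar j)%:F) f.

Definition isobaric_difference i j f : {fraction P} :=
  ((xvar i)%:F * laurent f - (xvar j)%:F * laurent (swapx i j f))
  / ((xvar i)%:F - (xvar j)%:F).

Definition is_double_grothendieck (G : 'S_n -> P) : Prop :=
  laurent (G (longest_perm n)) =
    \prod_(i < n) \prod_(j < n | (i.+1 + j.+1 <= n)%N)
      (1 - (yvar j)%:F / (xvar i)%:F) /\
  forall (w : 'S_n) i j, j = i.+1 :> nat -> (w j < w i)%N ->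
    laurent (G (tperm i j * w)%g) = isobaric_difference i j (G w).

End Polynomials.

Section Permutations.
Variable n : nat.
Implicit Types u v w : 'S_n.

Lemma perm_length_max w : (perm_length w <= perm_length (longest_perm n))%N.
Proof.
apply/subset_leq_card/subsetP => -[i j]; rewrite !inE !permE /= => /andP[lij _].
by rewrite lij /=; have := ltn_ord j; lia.
Qed.

Definition weight w : nat := (\sum_(i < n) i * w i)%N.

Lemma weight_lt w (i j : 'I_n) :
  (i < j)%N -> (w i < w j)%N -> (weight (tperm i j * w) < weight w)%N.
Proof.
move=> lij lw; have nij : j != i by apply/eqP => e; rewrite e ltnn in lij.
rewrite /weight (bigD1 i) // (bigD1 j) //= [X in (_ < X)%N](bigD1 i) //.
rewrite [X in (_ < _ + X)%N](bigD1 j) //= !permM tpermL tpermR.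
rewrite (eq_bigr (fun k : 'I_n => k * w k)%N) ?addnA ?ltn_add2r; first by nia.
by move=> k /andP[ki kj]; rewrite permM tpermD // eq_sym.
Qed.

Lemma no_ascent w :
  (forall i j : 'I_n, j = i.+1 :> nat -> (w i < w j)%N = false) ->
  w = longest_perm n.
Proof.
move=> na.
have dec (i j : 'I_n) : j = i.+1 :> nat -> (w j < w i)%N.
  move=> ij; have := na _ _ ij; have : w i != w j :> nat.
    by apply/eqP => /val_inj/perm_inj e; rewrite e in ij; lia.
  lia.
have up m : forall i : 'I_n, i = m :> nat -> (w i + m < n)%N.
  elim: m => [|m IH] i im; first by rewrite addn0.
  have lm : (m < n)%N by have := ltn_ord i; lia.
  by have := IH (Ordinal lm) erefl; have := dec (Ordinal lm) i im; lia.
have lo m : forall i : 'I_n, (i + m).+1 = n -> (m <= w i)%N.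
  elim: m => [|m IH] i im //.
  have lm : (i.+1 < n)%N by lia.
  have im' : ((Ordinal lm : nat) + m).+1 = n by rewrite /=; lia.
  by have := IH (Ordinal lm) im'; have := dec i (Ordinal lm) erefl; lia.
apply/permP => i; apply/val_inj; rewrite permE /=.
have li := ltn_ord i; have := up i i erefl.
have e : (i + (n - i.+1)).+1 = n by lia.
by have := lo _ i e; lia.
Qed.

End Permutations.

Lemma descent_unique (n : nat) (T : Type) (S1 S2 : 'S_n -> T) :
  S1 (longest_perm n) = S2 (longest_perm n) ->
  (forall (w : 'S_n) (i j : 'I_n), j = i.+1 :> nat -> (w j < w i)%N ->
    S1 w = S2 w -> S1 (tperm i j * w)%g = S2 (tperm i j * w)%g) ->
  S1 =1 S2.
Proof.
move=> S0 Srec w; move: {2}(weight w).+1 (ltnSn (weight w)) => N.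
elim: N w => // N IH w wN.
case: (pickP [pred p : 'I_n * 'I_n | (p.2 == p.1.+1 :> nat) &&
  (w p.1 < w p.2)%N]) => [[i j] /= /andP[/eqP ij wij]|none].
  rewrite -[w](mulKg (tperm i j)) tpermV; apply: Srec => //.
    by rewrite !permM tpermL tpermR.
  have lij : (i < j)%N by lia.
  by apply: IH; move: (weight_lt lij wij) wN; rewrite ltnS; apply: leq_trans.
suff -> : w = longest_perm n by [].
by apply: no_ascent => i j ij; have /= := none (i, j); rewrite ij eqxx.
Qed.

Section DescentRecursion.
Variables (n : nat) (T : Type) (top : T) (D : 'I_n -> 'I_n -> T -> T).

Definition descent_rec (S : 'S_n -> T) : Prop :=
  S (longest_perm n) = top /\
  forall (w : 'S_n) (i j : 'I_n), j = i.+1 :> nat -> (w j < w i)%N ->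
    S (tperm i j * w)%g = D i j (S w).

Hypothesis Dcomm : forall (i j k l : 'I_n) f, j = i.+1 :> nat ->
  l = k.+1 :> nat -> (j < k)%N -> D i j (D k l f) = D k l (D i j f).
Hypothesis Dbraid : forall (i j k : 'I_n) f, j = i.+1 :> nat ->
  k = j.+1 :> nat -> D i j (D j k (D i j f)) = D j k (D i j (D j k f)).

Fixpoint descent_fun (m : nat) (w : 'S_n) : T :=
  if m is m'.+1 then
    if [pick p : 'I_n * 'I_n | (p.2 == p.1.+1 :> nat) && (w p.1 < w p.2)%N]
      is Some p then D p.1 p.2 (descent_fun m' (tperm p.1 p.2 * w)%g)
    else top
  else top.

Lemma descent_fun_ascent m (w : 'S_n) (i j : 'I_n) :
  (weight w < m)%N -> j = i.+1 :> nat -> (w i < w j)%N ->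
  forall m', (weight (tperm i j * w) < m')%N ->
  descent_fun m w = D i j (descent_fun m' (tperm i j * w)).
Proof.
move: {2}(weight w).+1 (ltnSn (weight w)) => N.
elim: N m w i j => // N IH m w i j wN wm ij wij m' hm'.
case: m wm => // m wm.
have indep (u : 'S_n) m1 m2 : (weight u < weight w)%N -> (weight u < m1)%N ->
    (weight u < m2)%N -> descent_fun m1 u = descent_fun m2 u.
  move=> uw; case: m1 => // m1; case: m2 => // m2 um1 um2 /=.
  case: pickP => // -[a b] /= /andP[/eqP ab uab].
  have lt := weight_lt (w := u) (i := a) (j := b).
  have {}lt : (weight (tperm a b * u) < weight u)%N by apply: lt => //; lia.
  have -> : descent_fun m1 (tperm a b * u) = descent_fun m2 (tperm a b * u).
    case: (pickP [pred p : 'I_n * 'I_n | (p.2 == p.1.+1 :> nat) &&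
       ((tperm a b * u)%g p.1 < (tperm a b * u)%g p.2)%N]) => [[c d]|none].
      move=> /= /andP[/eqP cd ucd].
      by rewrite !(IH _ _ c d _ _ cd ucd (weight (tperm a b * u))) //; 
        try (apply: weight_lt => //); lia.
    by case: (m1) => [|?]; case: (m2) => [|?] //=; rewrite ?none //;
      case: pickP => // ? /=; have /= -> := none _.
  by [].
(* any two ascents of w give the same value *)
have diamond (a b c d : 'I_n) m1 m2 : b = a.+1 :> nat -> d = c.+1 :> nat ->
    (a < c)%N -> (w a < w b)%N -> (w c < w d)%N ->
    (weight (tperm a b * w) < m1)%N -> (weight (tperm c d * w) < m2)%N ->
    D a b (descent_fun m1 (tperm a b * w)) =
    D c d (descent_fun m2 (tperm c d * w)).
  move=> ab cd ac wab wcd hm1 hm2.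
  have lab : (weight (tperm a b * w) < weight w)%N by apply: weight_lt => //; lia.
  have lcd : (weight (tperm c d * w) < weight w)%N by apply: weight_lt => //; lia.
  have neq (x y : 'I_n) : (x < y)%N -> (x != y) * (y != x).
    by move=> xy; split; apply/eqP => e; rewrite e ltnn in xy.
  have step m0 (u : 'S_n) (x y : 'I_n) : (weight u < weight w)%N -> (weight u < m0)%N ->
     y = x.+1 :> nat -> (u x < u y)%N ->
     descent_fun m0 u = D x y (descent_fun m0 (tperm x y * u)).
    move=> lu lm xy uxy; apply: IH => //; first by lia.
    by apply: ltn_trans lm; apply: weight_lt => //; lia.
  have [bc|bc] := ltnP b c.
    have acd := neq _ _ ac; have bcd := neq _ _ bc.
    have bd : (b < d)%N by lia. have ad : (a < d)%N by lia.
    have {}bd := neq _ _ bd; have {}ad := neq _ _ ad.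
    have E : (tperm a b c = c) * (tperm a b d = d) * (tperm c d a = a) *
             (tperm c d b = b).
      by split; [split; [split |] |]; rewrite tpermD ?acd ?bcd ?ad ?bd.
    have com : (tperm a b * (tperm c d * w) = tperm c d * (tperm a b * w))%g.
      apply/permP => x; rewrite !permM; congr (w _).
      have [->|xa] := eqVneq x a.
        by rewrite !(tpermL, tpermR, E).
      have [->|xb] := eqVneq x b.
        by rewrite !(tpermL, tpermR, E).
      have [->|xc] := eqVneq x c.
        by rewrite !(tpermL, tpermR, E).
      have [->|xd] := eqVneq x d.
        by rewrite !(tpermL, tpermR, E).
      by rewrite !tpermD // eq_sym.
    rewrite (step m1 _ c d) // ?permM ?E //.
    rewrite (step m2 _ a b) // ?permM ?E //.
    rewrite Dcomm // com; congr (D _ _ (D _ _ _)).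
    have l2 : (weight (tperm c d * (tperm a b * w)) < weight (tperm a b * w))%N.
      by apply: weight_lt; rewrite ?permM ?E //; lia.
    have l3 : (weight (tperm a b * (tperm c d * w)) < weight (tperm c d * w))%N.
      by apply: weight_lt; rewrite ?permM ?E //; lia.
    by rewrite com in l3; apply: indep; lia.
  have e : c = b by apply/val_inj => /=; lia.
  rewrite {c bc}e in cd ac wcd hm2 lcd *.
  have bd : (b < d)%N by lia. have ad : (a < d)%N by lia.
  have [nab nba] := neq _ _ ac; have [nbd ndb] := neq _ _ bd.
  have [nad nda] := neq _ _ ad.
  have E : (tperm a b d = d) * (tperm b d a = a).
    by split; rewrite tpermD.
  have braid : (tperm a b * (tperm b d * (tperm a b * w)) =
                tperm b d * (tperm a b * (tperm b d * w)))%g.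
    apply/permP => x; rewrite !permM; congr (w _).
    have [->|xa] := eqVneq x a.
      by rewrite !(tpermL, tpermR, E).
    have [->|xb] := eqVneq x b.
      by rewrite !(tpermL, tpermR, E).
    have [->|xd] := eqVneq x d.
      by rewrite !(tpermL, tpermR, E).
    by rewrite !tpermD // eq_sym.
  pose E' := (tpermL, tpermR, E, permM).
  have l1 : (weight (tperm b d * (tperm a b * w)) < weight (tperm a b * w))%N.
    by apply: weight_lt; rewrite ?E'; lia.
  have l2 : (weight (tperm a b * (tperm b d * w)) < weight (tperm b d * w))%N.
    by apply: weight_lt; rewrite ?E'; lia.
  have l1' : (weight (tperm a b * (tperm b d * (tperm a b * w)))
            < weight (tperm b d * (tperm a b * w)))%N.
    by apply: weight_lt; rewrite ?E'; lia.
  have l2' : (weight (tperm b d * (tperm a b * (tperm b d * w)))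
            < weight (tperm a b * (tperm b d * w)))%N.
    by apply: weight_lt; rewrite ?E'; lia.
  rewrite (step m1 _ b d) //; last by rewrite ?E'; lia.
  rewrite (step m1 _ a b) //; try lia; last by rewrite ?E'; lia.
  rewrite (step m2 _ a b) //; last by rewrite ?E'; lia.
  rewrite (step m2 _ b d) //; try lia; last by rewrite ?E'; lia.
  rewrite Dbraid // braid; congr (D _ _ (D _ _ (D _ _ _))).
  by rewrite braid in l1'; apply: indep; lia.
rewrite /=; case: pickP => [[c d]|none]; last first.
  by have /= := none (i, j); rewrite ij eqxx wij.
move=> /= /andP[/eqP cd wcd].
have lcd : (weight (tperm c d * w) < weight w)%N by apply: weight_lt => //; lia.
have lij : (weight (tperm i j * w) < weight w)%N by apply: weight_lt => //; lia.
have [ci|ic|e] := ltngtP c i.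
- by apply: diamond => //; lia.
- by apply/esym/diamond => //; lia.
have ei : c = i by apply/val_inj.
have ej : d = j by apply/val_inj; rewrite /= ij cd e.
by rewrite ei ej; congr (D _ _ _); apply: indep => //; rewrite ?ei ?ej in lcd *; lia.
Qed.

Lemma descent_rec_exists : {S : 'S_n -> T | descent_rec S}.
Proof.
exists (fun w => descent_fun (weight w).+1 w); split => [|w i j ij wji].
  rewrite /=; case: pickP => // -[i j] /= /andP[/eqP ij]; rewrite !permE /=.
  by lia.
rewrite (descent_fun_ascent (i := i) (j := j) _ _ _ (m' := (weight w).+1)) //.
- by rewrite mulgA tperm2 mul1g.
- by rewrite !permM tpermL tpermR.
- by rewrite mulgA tperm2 mul1g.
Qed.

End DescentRecursion.

Section FieldIdentities.
Variable F : fieldType.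
Implicit Types x y z t f : F.

Lemma divdiff_braid_id x y z f1 f2 f3 f4 f5 f6 :
  x - y != 0 -> y - z != 0 -> x - z != 0 ->
  ((((f1 - f2) / (x - y) - (f3 - f4) / (x - z)) / (y - z))
   - (((f2 - f1) / (y - x) - (f5 - f6) / (y - z)) / (x - z))) / (x - y) =
  ((((f1 - f3) / (y - z) - (f2 - f5) / (x - z)) / (x - y))
   - (((f3 - f1) / (z - y) - (f4 - f6) / (x - y)) / (x - z))) / (y - z).
Proof.
move=> xy yz xz.
have yx : y - x != 0 by rewrite -opprB oppr_eq0.
have zy : z - y != 0 by rewrite -opprB oppr_eq0.
by field; rewrite xy yz xz yx zy.
Qed.

Lemma demazure_braid_id x y z f1 f2 f3 f4 f5 f6 :
  x - y != 0 -> y - z != 0 -> x - z != 0 ->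
  (y * ((z * ((y * f1 - x * f2) / (y - x)) - y * ((z * f3 - x * f4) / (z - x)))
       / (z - y))
   - x * ((z * ((x * f2 - y * f1) / (x - y)) - x * ((z * f5 - y * f6) / (z - y)))
       / (z - x))) / (y - x) =
  (z * ((y * ((z * f1 - y * f3) / (z - y)) - x * ((z * f2 - x * f5) / (z - x)))
       / (y - x))
   - y * ((z * ((y * f3 - z * f1) / (y - z)) - x * ((y * f4 - x * f6) / (y - x)))
       / (z - x))) / (z - y).
Proof.
move=> xy yz xz.
have yx : y - x != 0 by rewrite -opprB oppr_eq0.
have zy : z - y != 0 by rewrite -opprB oppr_eq0.
have zx : z - x != 0 by rewrite -opprB oppr_eq0.
by field; rewrite xy yz yx zy zx.
Qed.

Lemma divdiff_comm_id x y z t f1 f2 f3 f4 : x - y != 0 -> z - t != 0 ->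
  ((f1 - f2) / (z - t) - (f3 - f4) / (z - t)) / (x - y) =
  ((f1 - f3) / (x - y) - (f2 - f4) / (x - y)) / (z - t).
Proof. by move=> xy zt; field; rewrite xy zt. Qed.

Lemma demazure_comm_id x y z t f1 f2 f3 f4 : x - y != 0 -> z - t != 0 ->
  (x * ((z * f1 - t * f2) / (z - t)) - y * ((z * f3 - t * f4) / (z - t)))
    / (x - y) =
  (z * ((x * f1 - y * f3) / (x - y)) - t * ((x * f2 - y * f4) / (x - y)))
    / (z - t).
Proof. by move=> xy zt; field; rewrite xy zt. Qed.

Lemma demazure_laurent_id x y q f1 f2 : x != 0 -> y != 0 -> x - y != 0 ->
  y^-1 * f1 - x^-1 * f2 = (x^-1 - y^-1) * q ->
  - q = (x * f1 - y * f2) / (x - y).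
Proof.
move=> x0 y0 xy e; have yx : y - x != 0 by rewrite -opprB oppr_eq0.
have -> : q = (y^-1 * f1 - x^-1 * f2) / (x^-1 - y^-1).
  rewrite e mulrAC divff ?mul1r //.
  by rewrite subr_eq0 (inj_eq invr_inj) -subr_eq0.
by field; rewrite mulN1r xy y0 x0.
Qed.

End FieldIdentities.

Section OperatorRelations.
Variables (n : nat) (T : Type) (F : fieldType).
Variables (M : 'S_(n + n) -> T -> F) (Y : 'I_(n + n) -> F).
Variables (D1 D2 : 'I_n -> 'I_n -> T -> T).
Hypothesis YB_neq0 : forall i j : 'I_n,
  i != j -> Y (lshift n i) - Y (lshift n j) != 0.
Hypothesis D1E : forall s (i j : 'I_n) f, i != j ->
  M s (D1 i j f) =
  (M s f - M (tperm (lshift n i) (lshift n j) * s)%g f)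
  / (Y (s (lshift n i)) - Y (s (lshift n j))).
Hypothesis D2E : forall s (i j : 'I_n) f, i != j ->
  M s (D2 i j f) =
  (Y (s (lshift n j)) * M s f
   - Y (s (lshift n i)) * M (tperm (lshift n i) (lshift n j) * s)%g f)
  / (Y (s (lshift n j)) - Y (s (lshift n i))).

Lemma adjacent_neq (i j k : 'I_n) : j = i.+1 :> nat -> (j < k)%N ->
  [/\ i != j, i != k & j != k].
Proof. by move=> ij jk; split; apply/eqP => /(congr1 val) /=; lia. Qed.

Section Far.
Variables i j k l : 'I_n.
Hypotheses (ij : j = i.+1 :> nat) (kl : l = k.+1 :> nat) (jk : (j < k)%N).
Let s := tperm (lshift n i) (lshift n j).
Let t := tperm (lshift n k) (lshift n l).

Lemma farE : [/\ i != j, k != l, (s * t = t * s)%g,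
  (t (lshift n i) = lshift n i) * (t (lshift n j) = lshift n j) &
  (s (lshift n k) = lshift n k) * (s (lshift n l) = lshift n l)].
Proof.
have [nij nik njk] := adjacent_neq ij jk.
have jl : (j < l)%N by lia.
have [_ nil njl] := adjacent_neq ij jl.
have nkl : k != l by apply/eqP => /(congr1 val) /=; lia.
have e := inj_eq (@lshift_inj n n).
have E : ((t (lshift n i) = lshift n i) * (t (lshift n j) = lshift n j)) *
  ((s (lshift n k) = lshift n k) * (s (lshift n l) = lshift n l)).
  by do ![split]; rewrite /s /t tpermD // e // eq_sym.
split => //; try exact: E.1; try exact: E.2.
apply/permP => x; rewrite !permM.
have [->|xi] := eqVneq x (lshift n i); first by rewrite tpermL !E tpermL.
have [->|xj] := eqVneq x (lshift n j); first by rewrite tpermR !E tpermR.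
have [->|xk] := eqVneq x (lshift n k); first by rewrite !E !tpermL !E.
have [->|xl] := eqVneq x (lshift n l); first by rewrite !E !tpermR !E.
by rewrite /s /t !tpermD // eq_sym.
Qed.

Lemma divdiff_comm_at f :
  M 1%g (D1 i j (D1 k l f)) = M 1%g (D1 k l (D1 i j f)).
Proof.
have [nij nkl st tE sE] := farE.
rewrite !D1E // -/s -/t !mulg1 !perm1 !sE !tE st.
by apply: divdiff_comm_id; apply: YB_neq0.
Qed.

Lemma demazure_comm_at f :
  M 1%g (D2 i j (D2 k l f)) = M 1%g (D2 k l (D2 i j f)).
Proof.
have [nij nkl st tE sE] := farE.
rewrite !D2E // -/s -/t !mulg1 !perm1 !sE !tE st.
by apply: demazure_comm_id; apply: YB_neq0; rewrite eq_sym.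
Qed.

End Far.

Section Braid.
Variables i j k : 'I_n.
Hypotheses (ij : j = i.+1 :> nat) (jk : k = j.+1 :> nat).
Let a := lshift n i.
Let b := lshift n j.
Let c := lshift n k.
Let s := tperm a b.
Let t := tperm b c.

Lemma braidE : [/\ i != j, j != k, i != k, (s * (t * s) = t * (s * t))%g &
  (s a = b) * (s b = a) * (s c = c) * (t a = a) * (t b = c) * (t c = b)].
Proof.
have jk' : (j < k)%N by lia.
have [nij nik njk] := adjacent_neq ij jk'.
have e := inj_eq (@lshift_inj n n).
have E : (s a = b) * (s b = a) * (s c = c) * (t a = a) * (t b = c) * (t c = b).
  by do ![split]; rewrite /s /t ?tpermL ?tpermR // tpermD // e // eq_sym.
split => //; apply/permP => x; rewrite !permM.
have [->|xa] := eqVneq x a; first by rewrite !E.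
have [->|xb] := eqVneq x b; first by rewrite !E.
have [->|xc] := eqVneq x c; first by rewrite !E.
by rewrite /s /t !tpermD // eq_sym.
Qed.

Lemma divdiff_braid_at f :
  M 1%g (D1 i j (D1 j k (D1 i j f))) = M 1%g (D1 j k (D1 i j (D1 j k f))).
Proof.
have [nij njk nik st E] := braidE.
rewrite !D1E // -/a -/b -/c -/s -/t !mulg1 !permM !perm1 !E !tperm2 st.
by apply: divdiff_braid_id; apply: YB_neq0.
Qed.

Lemma demazure_braid_at f :
  M 1%g (D2 i j (D2 j k (D2 i j f))) = M 1%g (D2 j k (D2 i j (D2 j k f))).
Proof.
have [nij njk nik st E] := braidE.
rewrite !D2E // -/a -/b -/c -/s -/t !mulg1 !permM !perm1 !E !tperm2 st.
by apply: demazure_braid_id; apply: YB_neq0.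
Qed.

End Braid.

End OperatorRelations.

Section Polynomials.
Variable n : nat.
Local Notation P := {mpoly int[n + n]}.
Implicit Types (f g : P) (i j : 'I_n).

Section Eval2.
Variables (K : comNzRingType) (u v : 'I_n -> K).

Lemma eval2B : {morph eval2 u v : f g / f - g}. Proof. exact: mmapB. Qed.
Lemma eval2M : {morph eval2 u v : f g / f * g}. Proof. exact: rmorphM. Qed.
Lemma eval2N : {morph eval2 u v : f / - f}. Proof. exact: mmapN. Qed.
Lemma eval2_1 : eval2 u v 1 = 1. Proof. exact: rmorph1. Qed.
Lemma eval2_x i : eval2 u v (xvar i) = u i.
Proof. by rewrite /eval2 mmapX mmap1U -/(unsplit (inl i)) unsplitK. Qed.
Lemma eval2_y j : eval2 u v (yvar j) = v j.
Proof. by rewrite /eval2 mmapX mmap1U -/(unsplit (inr j)) unsplitK. Qed.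
Lemma eval2_prod (I : Type) (r : seq I) (p : pred I) F :
  eval2 u v (\prod_(i <- r | p i) F i) = \prod_(i <- r | p i) eval2 u v (F i).
Proof. exact: (big_morph _ eval2M eval2_1). Qed.

End Eval2.

Lemma mvar_inj (k l : 'I_(n + n)) : ('X_k == 'X_l :> P) = (k == l).
Proof.
apply/eqP/eqP => [e|-> //].
have := congr1 (mcoeff U_(k)) e; rewrite !mcoeffX eqxx.
by case: eqP => // /mnmP/(_ k); rewrite !mnm1E eqxx; case: eqP.
Qed.

Lemma xvarF_eq i j : ((xvar i)%:F == (xvar j)%:F) = (i == j).
Proof. by rewrite tofrac_eq mvar_inj (inj_eq (@lshift_inj _ _)). Qed.

Lemma xvarB_neq0 i j : i != j -> (xvar i)%:F - (xvar j)%:F != 0.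
Proof. by rewrite subr_eq0 xvarF_eq. Qed.

Lemma xvar_neq0 i : (xvar i)%:F != 0.
Proof.
rewrite tofrac_eq0; apply/eqP => /(congr1 (mcoeff U_(lshift n i))).
by rewrite mcoeffX eqxx mcoeff0.
Qed.

Lemma msym_var (s : 'S_(n + n)) k : msym s 'X_k = 'X_(s k) :> P.
Proof. by rewrite /msym mmapX mmap1U. Qed.

Lemma divdiff_exists i j f :
  {q : P | f - swapx i j f = (xvar i - xvar j) * q}.
Proof.
set d := xvar i - xvar j; pose D g := {q : P | g - swapx i j g = d * q}.
have DM g h : D g -> D h -> D (g * h).
  move=> [q qE] [r rE]; exists (q * h + swapx i j g * r).
  rewrite mulrDr mulrA -qE mulrCA -rE /swapx msymM; ring.
have D1 : D 1 by exists 0; rewrite /swapx msym1; ring.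
have DX k : D 'X_k.
  rewrite /D /swapx msym_var; case: tpermP => [->|->|_ _].
  - by exists 1; rewrite mulr1.
  - by exists (-1); rewrite mulrN1 opprB.
  - by exists 0; rewrite subrr mulr0.
have DXn k e : D ('X_k ^+ e).
  elim: e => [|e IH]; rewrite ?expr0 // exprS.
  exact: DM (DX k) IH.
elim/mpolyrect: f => [|c m g _ _ [q qE]].
  by exists 0; rewrite /swapx msym0; ring.
have [r rE] : D 'X_[m].
  rewrite mpolyXE_id; apply: (big_rec D D1) => k h _ Dh.
  exact: DM (DXn k _) Dh.
exists (c *: r + q).
rewrite mulrDr -scalerAr -rE -qE /swapx msymD msymZ scalerBr.
by rewrite opprD addrACA.
Qed.

Definition divdiff i j f : P := sval (divdiff_exists i j f).
Definition demazure i j f : P := - divdiff i j (xvar j * f).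

Section Relations.
Variables (F : fieldType) (phi : {rmorphism P -> F}).
Hypothesis phi_inj : injective phi.
Local Notation pX k := (phi 'X_k).

Lemma phiB_neq0 i j : i != j -> pX (lshift n i) - pX (lshift n j) != 0.
Proof.
by rewrite subr_eq0 (inj_eq phi_inj) mvar_inj (inj_eq (@lshift_inj _ _)).
Qed.

Lemma divdiffE (s : 'S_(n + n)) i j f : i != j ->
  phi (msym s (divdiff i j f)) =
  (phi (msym s f) - phi (msym (tperm (lshift n i) (lshift n j) * s)%g f))
  / (pX (s (lshift n i)) - pX (s (lshift n j))).
Proof.
move=> nij; rewrite msymMm -!(rmorphB phi) -!msym_var -!msymB.
have := svalP (divdiff_exists i j f); rewrite -/(divdiff i j f) /swapx => ->.
rewrite msymM (rmorphM phi) mulrAC divff ?mul1r // msymB !msym_var (rmorphB phi) subr_eq0.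
rewrite (inj_eq phi_inj) mvar_inj (inj_eq perm_inj).
by rewrite (inj_eq (@lshift_inj _ _)).
Qed.

Lemma demazureE (s : 'S_(n + n)) i j f : i != j ->
  phi (msym s (demazure i j f)) =
  (pX (s (lshift n j)) * phi (msym s f)
   - pX (s (lshift n i)) *
     phi (msym (tperm (lshift n i) (lshift n j) * s)%g f))
  / (pX (s (lshift n j)) - pX (s (lshift n i))).
Proof.
move=> nij; rewrite /demazure msymN (rmorphN phi) divdiffE // !msymM !(rmorphM phi).
rewrite !msym_var permM tpermR -[X in _ = _ / X]opprB invrN mulrN.
by [].
Qed.


Let M (s : 'S_(n + n)) f := phi (msym s f).
Let Y k := pX k.

Let M1_inj : injective (M 1%g).
Proof. by move=> f g; rewrite /M !msym1m => /phi_inj. Qed.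

Lemma divdiff_comm i j (k l : 'I_n) f : j = i.+1 :> nat -> l = k.+1 :> nat ->
  (j < k)%N -> divdiff i j (divdiff k l f) = divdiff k l (divdiff i j f).
Proof.
move=> ij kl jk; apply: M1_inj.
exact: (divdiff_comm_at (Y := Y) phiB_neq0 divdiffE ij kl jk).
Qed.

Lemma demazure_comm i j (k l : 'I_n) f : j = i.+1 :> nat -> l = k.+1 :> nat ->
  (j < k)%N -> demazure i j (demazure k l f) = demazure k l (demazure i j f).
Proof.
move=> ij kl jk; apply: M1_inj.
exact: (demazure_comm_at (Y := Y) phiB_neq0 demazureE ij kl jk).
Qed.

Lemma divdiff_braid i j (k : 'I_n) f : j = i.+1 :> nat -> k = j.+1 :> nat ->
  divdiff i j (divdiff j k (divdiff i j f)) =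
  divdiff j k (divdiff i j (divdiff j k f)).
Proof.
move=> ij jk; apply: M1_inj.
exact: (divdiff_braid_at (Y := Y) phiB_neq0 divdiffE ij jk).
Qed.

Lemma demazure_braid i j (k : 'I_n) f : j = i.+1 :> nat -> k = j.+1 :> nat ->
  demazure i j (demazure j k (demazure i j f)) =
  demazure j k (demazure i j (demazure j k f)).
Proof.
move=> ij jk; apply: M1_inj.
exact: (demazure_braid_at (Y := Y) phiB_neq0 demazureE ij jk).
Qed.

Lemma laurent_eval_demazure (a b : 'I_n -> F) i j f :
  a i != 0 -> a j != 0 -> a i != a j ->
  laurent_eval a b (demazure i j f) =
  (a i * laurent_eval a b f - a j * laurent_eval a b (swapx i j f))
  / (a i - a j).
Proof.
move=> ai aj; rewrite -subr_eq0 => aij; rewrite /demazure /laurent_eval eval2N.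
have := svalP (divdiff_exists i j (xvar j * f)); rewrite -/(divdiff _ _ _).
rewrite {1}/swapx msymM msym_var tpermR -/(swapx i j f) -/(xvar i).
move=> /(congr1 (eval2 (fun i => (a i)^-1) b)).
by rewrite eval2B !eval2M eval2B !eval2_x; apply: demazure_laurent_id.
Qed.

Definition clear_exponents N (m : 'X_{1..n + n}) : 'X_{1..n + n} :=
  [multinom if split k is inl _ then (N - m k)%N else m k | k < n + n].

Lemma clear_exponentsK N (m : 'X_{1..n + n}) :
  (forall k, m k <= N)%N -> clear_exponents N (clear_exponents N m) = m.
Proof.
move=> mN; apply/mnmP => k; rewrite !mnmE; case: (split k) => // _.
by rewrite subKn.
Qed.

Let x_ i := phi (xvar i).
Let y_ j := phi (yvar j).

Lemma phi_xvar_neq0 i : phi (xvar i) != 0.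
Proof.
rewrite -(rmorph0 phi) (inj_eq phi_inj).
apply/eqP => /(congr1 (mcoeff U_(lshift n i))).
by rewrite mcoeffX eqxx mcoeff0.
Qed.

Lemma clear_monomial N (m : 'X_{1..n + n}) : (forall k, m k <= N)%N ->
  mmap1 (fun c : 'I_(n + n) =>
    match split c with inl i => (x_ i)^-1 | inr j => y_ j end) m
  * \prod_(i < n) x_ i ^+ N = phi 'X_[clear_exponents N m].
Proof.
move=> mN; rewrite mpolyXE_id rmorph_prod /mmap1 !big_split_ord /= mulrAC.
rewrite -big_split /=; congr (_ * _); apply: eq_bigr => i _; rewrite rmorphXn.
  rewrite mnmE -/(unsplit (inl i)) unsplitK /= exprVn mulrC.
  rewrite -[in LHS](subnK (mN (lshift n i))) exprD mulfK //.
  by rewrite expf_neq0 ?phi_xvar_neq0.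
by rewrite mnmE -/(unsplit (inr i)) unsplitK.
Qed.

Lemma laurent_eval_eq0 f : laurent_eval x_ y_ f = 0 -> f = 0.
Proof.
move=> f0; set N := msize f.
have mN m : m \in msupp f -> forall k, (m k <= N)%N.
  move=> mf k; apply: (@leq_trans (mdeg m)).
    by rewrite mdegE (bigD1 k) //= leq_addr.
  exact/ltnW/msize_mdeg_lt.
pose q : P := \sum_(m <- msupp f) f@_m *: 'X_[clear_exponents N m].
have q0 : q = 0.
  apply: phi_inj; rewrite rmorph0 rmorph_sum /=.
  transitivity (laurent_eval x_ y_ f * \prod_(i < n) x_ i ^+ N); last first.
    by rewrite f0 mul0r.
  rewrite /laurent_eval /eval2 /mmap big_distrl /=; apply: eq_big_seq => m mf.
  rewrite -mulrA clear_monomial; last exact: mN.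
  by rewrite -[X in X *: _]intz scaler_int raddfMz mulrzl.
apply/mpolyP => m; rewrite mcoeff0; apply/eqP.
rewrite mcoeff_eq0; apply/negP => mf.
have := congr1 (mcoeff (clear_exponents N m)) q0.
rewrite mcoeff0 raddf_sum /= (bigD1_seq m) //= mcoeffZ mcoeffX eqxx mulr1.
rewrite big_seq_cond big1 ?addr0 => [/eqP|m' /andP[m'f m'm]].
  by rewrite mcoeff_eq0 mf.
rewrite mcoeffZ mcoeffX; case: eqP => [e|_]; last by rewrite mulr0.
move/(congr1 (clear_exponents N)): e m'm.
rewrite (clear_exponentsK (mN _ m'f)) (clear_exponentsK (mN _ mf)) => ->.
by rewrite eqxx.
Qed.

End Relations.

Let toF : {rmorphism P -> {fraction P}} := @FracField.tofrac P.

Lemma tofrac_injP : injective (@FracField.tofrac P).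
Proof. by move=> f g /eqP; rewrite tofrac_eq => /eqP. Qed.

Lemma double_schubert_exists : {S : 'S_n -> P | is_double_schubert S}.
Proof.
have [S [S0 Srec]] := descent_rec_exists
  (\prod_(i < n) \prod_(j < n | (i.+1 + j.+1 <= n)%N) (xvar i - yvar j))
  (fun i j k l f ij kl jk => divdiff_comm (phi := toF) tofrac_injP f ij kl jk)
  (fun i j k f ij jk => divdiff_braid (phi := toF) tofrac_injP f ij jk).
exists S; split=> // w i j ij wji; rewrite (Srec w i j ij wji).
have nij : i != j by apply/eqP => /(congr1 val) /=; lia.
rewrite -[divdiff _ _ _]msym1m (divdiffE (phi := toF) tofrac_injP) //.
by rewrite msym1m !perm1 mulg1.
Qed.

Lemma laurent_inj : injective (@laurent n).
Proof.
move=> f g; rewrite /laurent /laurent_eval => fg.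
apply/eqP; rewrite -subr_eq0; apply/eqP.
apply: (laurent_eval_eq0 (phi := toF) tofrac_injP).
by rewrite /laurent_eval eval2B fg subrr.
Qed.

Lemma double_grothendieck_exists : {G : 'S_n -> P | is_double_grothendieck G}.
Proof.
have [G [G0 Grec]] := descent_rec_exists
  (\prod_(i < n) \prod_(j < n | (i.+1 + j.+1 <= n)%N) (1 - yvar j * xvar i))
  (fun i j k l f ij kl jk => demazure_comm (phi := toF) tofrac_injP f ij kl jk)
  (fun i j k f ij jk => demazure_braid (phi := toF) tofrac_injP f ij jk).
exists G; split=> [|w i j ij wji].
  rewrite G0 /laurent /laurent_eval eval2_prod; apply: eq_bigr => i _.
  rewrite eval2_prod; apply: eq_bigr => j _.
  by rewrite eval2B eval2M eval2_1 eval2_x eval2_y.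
rewrite (Grec w i j ij wji).
have nij : i != j by apply/eqP => /(congr1 val) /=; lia.
by apply: laurent_eval_demazure; rewrite ?xvar_neq0 // xvarF_eq.
Qed.

Lemma double_schubert_unique (S1 S2 : 'S_n -> P) :
  is_double_schubert S1 -> is_double_schubert S2 -> S1 =1 S2.
Proof.
move=> [S10 S1r] [S20 S2r]; apply: descent_unique => [|w i j ij wji e].
  by rewrite S10 S20.
by apply: tofrac_injP; rewrite (S1r _ _ _ ij wji) (S2r _ _ _ ij wji) e.
Qed.

Lemma double_grothendieck_unique (G1 G2 : 'S_n -> P) :
  is_double_grothendieck G1 -> is_double_grothendieck G2 -> G1 =1 G2.
Proof.
move=> [G10 G1r] [G20 G2r]; apply: descent_unique => [|w i j ij wji e].
  by apply: laurent_inj; rewrite G10 G20.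
by apply: laurent_inj; rewrite (G1r _ _ _ ij wji) (G2r _ _ _ ij wji) e.
Qed.

Definition double_schubert : 'S_n -> P := sval double_schubert_exists.

Definition double_grothendieck : 'S_n -> P := sval double_grothendieck_exists.

Lemma double_schubertP : is_double_schubert double_schubert.
Proof. exact: svalP. Qed.

Lemma double_grothendieckP : is_double_grothendieck double_grothendieck.
Proof. exact: svalP. Qed.

End Polynomials.

(* Main.v *)
(* Write A(w, v) for the value of the polynomial of w at (y_v; y).  If i is a
   descent of both w and v, the divided difference recursion gives
     A(w s_i, v) = A(w s_i, v s_i),
     A(w, v) = a A(w, v s_i) + b A(w s_i, v s_i),
   with a = 1, b = y_v(i) - y_v(i+1) for Schubert polynomials and
   a = y_v(i+1) / y_v(i), b = 1 - a for Grothendieck polynomials; a and b are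
   positive when 0 < y_1 < ... < y_n.  Together with the lifting property of
   the Bruhat order, descending induction on w shows that A(w, v) = 0 unless
   w <= v, and ascending induction on v shows that A(w, v) is positive, hence
   nonzero, when w <= v. *)

Require Import Defs.
From HB Require Import structures.
From mathcomp Require Import all_boot all_order all_fingroup all_algebra.
From mathcomp Require Import zify ring.
From mathcomp.multinomials Require Import mpoly.

Set Implicit Arguments.
Unset Strict Implicit.
Unset Printing Implicit Defensive.

Import GRing.Theory.

(** * Length, descents and the Bruhat order *)

Section BruhatOrder.
Local Open Scope group_scope.
Variable n : nat.
Implicit Types (u v w : 'S_n) (i j : 'I_n).

(** [phi] applies t to both positions of an inversion of u where this keeps their order and leaves
    the inversion alone otherwise. It injects the inversions of u into those of u t and misses the
    pair (i, j). *)
Lemma perm_length_tperm u i j : (i < j)%N -> (u i < u j)%N ->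
  (perm_length u < perm_length (tperm i j * u))%N.
Proof.
move=> ij uij; set t := tperm i j; rewrite /perm_length.
pose phi (p : 'I_n * 'I_n) := if (t p.1 < t p.2)%N then (t p.1, t p.2) else p.
have phi_inj : {in [set p : 'I_n * 'I_n | (p.1 < p.2)%N && (u p.2 < u p.1)%N] &,
    injective phi}.
  move=> [p q] [p' q']; rewrite !inE /phi /= => /andP[pq _] /andP[pq' _].
  case: ifP => tpq; case: ifP => tpq' //.
  - by case=> /perm_inj -> /perm_inj ->.
  - by case=> e e'; move: tpq'; rewrite -e -e' !tpermK pq.
  - by case=> e e'; move: tpq; rewrite e e' !tpermK pq'.
rewrite -(card_in_imset phi_inj); apply: proper_card; apply/properP; split.
  apply/subsetP => _ /imsetP[[p q] pqI ->]; move: pqI.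
  rewrite !inE /phi /= => /andP[pq upq].
  case: ifP => [tpq|]; rewrite /= !permM ?tpermK ?upq ?tpq ?pq // => /negbT.
  rewrite -leqNgt /t; move: pq upq.
  by case: tpermP => [->|->|/eqP pi /eqP pj];
    case: tpermP => [->|->|/eqP qi /eqP qj] //; lia.
exists (i, j).
  by rewrite inE /= ij !permM tpermL tpermR.
apply/imsetP => -[[p q]]; rewrite inE /phi /= => /andP[pq upq].
case: ifP => tpq [e e']; last by move: upq; rewrite -e -e'; lia.
by move: pq; rewrite -(tpermK i j p) -(tpermK i j q) -/t -e -e' tpermL tpermR;
  lia.
Qed.

Lemma bruhat_step_tperm u i j : (i < j)%N -> (u i < u j)%N ->
  bruhat_step u (tperm i j * u).
Proof.
move=> ij uij; rewrite /bruhat_step perm_length_tperm //=.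
by apply/existsP; exists i; apply/existsP; exists j.
Qed.

Lemma bruhat_le_tperm u i j : (i < j)%N -> (u i < u j)%N ->
  bruhat_le u (tperm i j * u).
Proof. by move=> ij uij; apply/connect1/bruhat_step_tperm. Qed.

(** If u(j) < u(i), then [perm_length_tperm] applied to v would make v shorter than u. *)
Lemma bruhat_stepP u v : bruhat_step u v ->
  exists i j, [/\ (i < j)%N, (u i < u j)%N & v = (tperm i j * u)%g].
Proof.
case/andP=> luv /existsP[i /existsP[j /eqP ve]].
wlog ij : i j ve / (i < j)%N => [wl|].
  case: (ltngtP i j) => [|ji|/val_inj e]; first exact: wl.
    by apply: (wl j i); rewrite // tpermC.
  by move: luv; rewrite ve e tperm1 mul1g ltnn.
exists i, j; split=> //; case: (ltngtP (u i) (u j)) => // [uji|/val_inj/perm_inj e].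
  have := perm_length_tperm (u := v) ij.
  rewrite ve mulgA tperm2 mul1g !permM tpermL tpermR => /(_ uji).
  by rewrite -ve; lia.
by rewrite e ltnn in ij.
Qed.

Lemma bruhat_le_length u v : bruhat_le u v ->
  u != v -> (perm_length u < perm_length v)%N.
Proof.
case/connectP => p; elim: p u => [|x p IH] u /=; first by move=> _ ->; rewrite eqxx.
move=> /andP[/andP[ux _] /IH {}IH] /IH; case: (eqVneq x v) => [<- //|_ /(_ isT)].
by lia.
Qed.

(** For j = i + 1 this is the Bruhat-smaller of w and w s_i; it turns the lifting property into
    monotonicity. *)
Definition sort_at i j w : 'S_n := if (w j < w i)%N then (tperm i j * w)%g else w.

Lemma sort_at_le i j w : (i < j)%N -> bruhat_le (sort_at i j w) w.
Proof.
move=> ij; rewrite /sort_at; case: ifP => [wji|_]; last exact: connect0.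
have := @bruhat_le_tperm (tperm i j * w) i j ij.
by rewrite !permM tpermL tpermR mulgA tperm2 mul1g; apply.
Qed.

Lemma sort_at_tperm_le i j w : (i < j)%N ->
  bruhat_le (sort_at i j w) (tperm i j * w).
Proof.
move=> ij; rewrite /sort_at; case: ifP => [_|wji]; first exact: connect0.
apply: bruhat_le_tperm => //; rewrite ltn_neqAle leqNgt wji andbT.
by rewrite (inj_eq val_inj) (inj_eq perm_inj) neq_ltn ij.
Qed.

(* Unless it is the transposition of i and j = i + 1 itself, the transposition
   (k l) with k < l is conjugated by (i j) to the one of two positions in the
   same relative order, so the step from u to v is a step from u s to v s. *)
Lemma bruhat_lift u v i j : j = i.+1 :> nat -> bruhat_le u v ->
  bruhat_le (sort_at i j u) (sort_at i j v).
Proof.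
move=> ij; have lij : (i < j)%N by rewrite ij.
case/connectP => p; elim: p u => [|x p IH] u /=.
  by move=> _ ->; apply: connect0.
case/andP=> ux px vE; apply: connect_trans (IH x px vE) => {p IH px v vE}.
have [k [l [kl ukl xE]]] := bruhat_stepP ux.
rewrite {2}/sort_at; case: ifP => [xji|_]; last first.
  exact: connect_trans (sort_at_le u lij) (connect1 ux).
have [/andP[/eqP ki /eqP lj]|nkl] := boolP ((k == i) && (l == j)).
  by rewrite xE ki lj mulgA tperm2 mul1g; apply: sort_at_le.
apply: connect_trans (sort_at_tperm_le u lij) _.
set s := tperm i j.
have -> : (s * x = tperm (s k) (s l) * (s * u))%g.
  by rewrite xE -tpermJ conjgE tpermV -!mulgA [(s * (s * u))%g]mulgA tperm2 mul1g.
apply: bruhat_le_tperm; last by rewrite !permM !tpermK.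
move: nkl kl; rewrite /s.
case: tpermP => [->|->|/eqP + /eqP]; case: tpermP => [->|->|/eqP + /eqP];
  rewrite ?eqxx -?(inj_eq val_inj) /= ?ltnn //; lia.
Qed.

(** Composing with w_0 on the left exchanges ascents and descents. *)
Lemma no_descent v :
  (forall i j, j = i.+1 :> nat -> (v j < v i)%N = false) -> v = 1%g.
Proof.
move=> nd; apply: (mulIg (longest_perm n)); rewrite mul1g.
apply: no_ascent => i j ij; rewrite !permM !permE /=.
by have := nd i j ij; have := ltn_ord (v i); have := ltn_ord (v j); lia.
Qed.

(** Descending induction from w_0, the only permutation without ascents; turning an ascent into a
    descent lowers [weight]. *)
Lemma ascent_ind (P : 'S_n -> Prop) :
  P (longest_perm n) ->
  (forall w i j, j = i.+1 :> nat -> (w j < w i)%N ->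
    P w -> P (tperm i j * w)%g) ->
  forall w, P w.
Proof.
move=> P0 PS w; have [N] := ubnP (weight w); elim: N w => // N IH w wN.
case: (pickP [pred p : 'I_n * 'I_n | (p.2 == p.1.+1 :> nat) &&
    (w p.1 < w p.2)%N]) => [[i j] /= /andP[/eqP ij wij]|none]; last first.
  suff -> : w = longest_perm n by [].
  by apply: no_ascent => i j ij; have /= := none (i, j); rewrite ij eqxx.
rewrite -[w](mulKg (tperm i j)) tpermV; apply: PS => //.
  by rewrite !permM tpermL tpermR.
have lij : (i < j)%N by rewrite ij.
by apply: IH; apply: leq_trans (weight_lt lij wij) _.
Qed.

Lemma leq_perm_id w : (forall i, (w i <= i)%N) -> w = 1%g.
Proof.
move=> wle; apply/permP => i; rewrite perm1.
have [m] := ubnP (val i); elim: m i => // m IH i im.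
have := wle i; rewrite leq_eqVlt => /orP[/eqP/val_inj //|wi].
(* If w(i) < i, induction gives w(w(i)) = w(i), so w(i) = i by injectivity. *)
by have := IH (w i) (leq_trans wi im) => /perm_inj.
Qed.

(** Otherwise w_0 w(i) <= i for every i, so w_0 w is the identity. The factor with indices i and
    w(i) is what makes the polynomial of w_0 vanish at y_w. *)
Lemma not_longest w : w != longest_perm n ->
  exists i : 'I_n, (i.+1 + (w i).+1 <= n)%N.
Proof.
move=> wn; case: (pickP [pred i : 'I_n | i.+1 + (w i).+1 <= n])%N => [i|none].
  by exists i.
case/eqP: wn; apply: (mulIg (longest_perm n)).
have -> : (longest_perm n * longest_perm n = 1)%g.
  by apply/permP => i; rewrite permM !permE rev_ordK.
apply: leq_perm_id => i; rewrite permM permE /=.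
by have := none i => /=; have := ltn_ord (w i); lia.
Qed.

Lemma bruhat_le1 w : bruhat_le w 1 -> w = 1.
Proof.
move=> /bruhat_le_length lw; apply/eqP/idPn => /lw.
suff -> : perm_length (1 : 'S_n) = 0%N by [].
by apply: eq_card0 => -[i j]; rewrite !inE !perm1 /=; lia.
Qed.

End BruhatOrder.

Local Open Scope ring_scope.

(** * Support and positivity of any A(w, v) satisfying the recursion, for both families at once *)

Section PositiveRecursion.
Variables (n : nat) (F : fieldType) (pos : F -> Prop) (A : 'S_n -> 'S_n -> F).
Implicit Types (v w : 'S_n) (i j : 'I_n).

Hypothesis pos_neq0 : forall x, pos x -> x != 0.
Hypothesis posD : forall x y, pos x -> pos y -> pos (x + y).
Hypothesis posM : forall x y, pos x -> pos y -> pos (x * y).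
Hypothesis posV : forall x, pos x -> pos x^-1.

Hypothesis A_longest0 : forall v, v != longest_perm n -> A (longest_perm n) v = 0.
Hypothesis A_longest_pos : pos (A (longest_perm n) (longest_perm n)).
Hypothesis A_descent : forall w v i j, j = i.+1 :> nat ->
  (w j < w i)%N -> (v j < v i)%N ->
  A (tperm i j * w)%g v = A (tperm i j * w)%g (tperm i j * v)%g /\
  exists a b, [/\ pos a, pos b &
    A w v = a * A w (tperm i j * v)%g
            + b * A (tperm i j * w)%g (tperm i j * v)%g].

Lemma recursion_support w v : A w v != 0 -> bruhat_le w v.
Proof.
elim/ascent_ind: w v => [|w i j ij wji IH] v Av.
  by have [->|/A_longest0 A0] := eqVneq v (longest_perm n);
    [apply: connect0 | rewrite A0 eqxx in Av].
have lij : (i < j)%N by rewrite ij.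
set s := tperm i j in Av *.
(* [v'] is whichever of v and v s_i has the descent; v' s_i is the smaller of the two, and A(w s_i,
   .) takes the same value on both. *)
have [v' [v'ji sv'v {}Av]] : exists v', [/\ (v' j < v' i)%N,
    bruhat_le (s * v')%g v & A (s * w)%g (s * v')%g != 0].
  case: (ltngtP (v i) (v j)) => [vij|vji|/val_inj/perm_inj e].
  - exists (s * v)%g; rewrite !permM tpermL tpermR mulgA tperm2 mul1g.
    by split=> //; apply: connect0.
  - exists v; have [<- _] := A_descent ij wji vji; split=> //.
    by have := sort_at_le v lij; rewrite /sort_at vji.
  - by rewrite e ltnn in lij.
have sv'v' : bruhat_le (s * v')%g v'.
  by have := sort_at_le v' lij; rewrite /sort_at v'ji.
apply: connect_trans sv'v.
have -> : (s * v')%g = sort_at i j v' by rewrite /sort_at v'ji.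
have -> : (s * w)%g = sort_at i j w by rewrite /sort_at wji.
apply: bruhat_lift => //; have [_ [a [b [_ pb Aw]]]] := A_descent ij wji v'ji.
(* If A(w, v' s_i) vanishes, then A(w, v') = b A(w s_i, v' s_i) is nonzero; either way induction
   gives w <= v'. *)
have [A0|/IH wsv'] := eqVneq (A w (s * v')%g) 0; last exact: connect_trans wsv' _.
by apply: IH; rewrite Aw A0 mulr0 add0r mulf_neq0 // pos_neq0.
Qed.

(** Since w s_i is shorter than w, the support lemma gives A(w, w s_i) = 0. The recursion becomes
    A(w, w) = b A(w s_i, w s_i), and dividing by b carries positivity down from w_0. *)
Lemma recursion_diag w : pos (A w w).
Proof.
elim/ascent_ind: w => [//|w i j ij wji IH].
have lij : (i < j)%N by rewrite ij.
have [_ [a [b [_ pb Aw]]]] := A_descent ij wji wji.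
set s := tperm i j in Aw *.
have A0 : A w (s * w)%g = 0.
  apply/eqP/negPn/negP => /recursion_support/bruhat_le_length.
  have := @perm_length_tperm _ (s * w)%g i j lij.
  rewrite !permM tpermL tpermR mulgA tperm2 mul1g => /(_ wji) lsw.
  have [e|_ /(_ isT)] := eqVneq w (s * w)%g; last by lia.
  by rewrite -e ltnn in lsw.
have -> : A (s * w)%g (s * w)%g = A w w * b^-1.
  by rewrite [in RHS]Aw A0 mulr0 add0r mulrAC divff ?mul1r ?pos_neq0.
by apply: posM => //; apply: posV.
Qed.

Lemma recursion_pos w v : bruhat_le w v -> pos (A w v).
Proof.
have [N] := ubnP (perm_length v); elim: N v w => // N IH v w vN wv.
case: (pickP [pred p : 'I_n * 'I_n | (p.2 == p.1.+1 :> nat) &&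
    (v p.2 < v p.1)%N]) => [[i j] /= /andP[/eqP ij vji]|none]; last first.
  have v1 : v = 1%g.
    by apply: no_descent => i j ij; have /= := none (i, j); rewrite ij eqxx.
  by move: wv; rewrite v1 => /bruhat_le1 ->; apply: recursion_diag.
have lij : (i < j)%N by rewrite ij.
set s := tperm i j.
have svN : (perm_length (s * v)%g < N)%N.
  have := @perm_length_tperm _ (s * v)%g i j lij.
  rewrite !permM tpermL tpermR mulgA tperm2 mul1g => /(_ vji).
  by lia.
(* Lifting gives w s_i <= v s_i if w has a descent at i, and w <= v s_i otherwise. *)
have := bruhat_lift ij wv; rewrite {2}/sort_at vji /sort_at -/s.
case: ifP => [wji swsv|/negbT wij wsv].
  have [_ [a [b [pa pb ->]]]] := A_descent ij wji vji; rewrite -/s.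
  have pr := posM pb (IH _ _ svN swsv).
  (* A(w, v s_i) vanishes or, as the support lemma then gives w <= v s_i, is positive by
     induction. *)
  have [->|/recursion_support/(IH _ _ svN) pl] := eqVneq (A w (s * v)%g) 0.
    by rewrite mulr0 add0r.
  by apply: posD => //; apply: posM.
(* Here w s_i has the descent, so A(w, v) = A(w, v s_i). *)
have wji : ((s * w)%g j < (s * w)%g i)%N.
  rewrite !permM tpermL tpermR ltn_neqAle leqNgt wij andbT.
  by rewrite (inj_eq val_inj) (inj_eq perm_inj) neq_ltn lij.
have [+ _] := A_descent ij wji vji.
by rewrite -/s mulgA tperm2 mul1g => ->; apply: IH.
Qed.

Lemma bruhat_le_recursion w v : bruhat_le w v = (A w v != 0).
Proof.
by apply/idP/idP => [/recursion_pos/pos_neq0|/recursion_support].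
Qed.

End PositiveRecursion.

(** * Recursions between polynomials, ready for evaluation *)

(** For u = y_v this turns the interchange of x_i and x_j into the passage from v to v s_i. Both
    sides are additive and multiplicative in f, so variables suffice. *)
Lemma eval2_swapx (n : nat) (K : comNzRingType) (u u' z : 'I_n -> K)
    (i j : 'I_n) (f : {mpoly int[n + n]}) :
  (forall k, u' k = u (tperm i j k)) ->
  eval2 u z (swapx i j f) = eval2 u' z f.
Proof.
move=> u'E; pose E g := eval2 u z (swapx i j g) = eval2 u' z g.
have EM g h : E g -> E h -> E (g * h).
  by rewrite /E /swapx msymM !eval2M => -> ->.
have E1 : E 1 by rewrite /E /swapx msym1 !eval2_1.
have EX k : E 'X_k.
  rewrite /E /swapx msym_var -(splitK k); case: (split k) => [a|b] /=.
    rewrite -/(xvar a) eval2_x u'E.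
    rewrite -(inj_tperm _ _ _ (@lshift_inj n n)).
    by rewrite -/(xvar _) eval2_x.
  rewrite tpermD ?eq_lrshift // -/(yvar b) !eval2_y //.
have EXn k e : E ('X_k ^+ e).
  by elim: e => [|e IH]; rewrite ?expr0 // exprS; apply: EM (EX k) IH.
elim/mpolyrect: f => [|c m g _ _ Eg].
  by rewrite /E /swapx msym0 /eval2 !mmap0.
have Em : E 'X_[m].
  rewrite mpolyXE_id; apply: (big_rec E E1) => k h _; exact: EM (EXn k _).
rewrite /E /swapx msymD msymZ /eval2 !mmapD !mmapZ.
by congr (_ * _ + _).
Qed.

(** With the denominator cleared, the identity holds in the polynomial ring and survives evaluation
    at y_v. *)
Lemma double_schubert_descent (n : nat) (w : 'S_n) (i j : 'I_n) :
  j = i.+1 :> nat -> (w j < w i)%N ->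
  (xvar i - xvar j) * double_schubert (tperm i j * w)%g =
  double_schubert w - swapx i j (double_schubert w).
Proof.
move=> ij wji; have [_ Srec] := double_schubertP n.
have nij : i != j by apply/eqP => /(congr1 val) /=; lia.
apply: tofrac_injP; rewrite rmorphM rmorphB /= (Srec w i j ij wji).
by rewrite /divided_difference rmorphB /= mulrC divfK ?xvarB_neq0.
Qed.

(** Injectivity of [laurent] brings the defining identity back to the encoding polynomials, where it
    can be evaluated at other points. *)
Lemma double_grothendieck_longest (n : nat) :
  double_grothendieck (longest_perm n) =
  \prod_(i < n) \prod_(j < n | (i.+1 + j.+1 <= n)%N) (1 - yvar j * xvar i).
Proof.
have [G0 _] := double_grothendieckP n; apply: laurent_inj; rewrite G0.
rewrite /laurent /laurent_eval eval2_prod; apply: eq_bigr => i _.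
rewrite eval2_prod; apply: eq_bigr => j _.
by rewrite eval2B eval2M eval2_1 eval2_x eval2_y.
Qed.

Lemma double_grothendieck_descent (n : nat) (w : 'S_n) (i j : 'I_n) :
  j = i.+1 :> nat -> (w j < w i)%N ->
  double_grothendieck (tperm i j * w)%g = demazure i j (double_grothendieck w).
Proof.
move=> ij wji; have [_ Grec] := double_grothendieckP n.
have nij : i != j by apply/eqP => /(congr1 val) /=; lia.
apply: laurent_inj; rewrite (Grec w i j ij wji) /laurent.
by rewrite laurent_eval_demazure ?xvar_neq0 // xvarF_eq.
Qed.

(** * The values A(w, v) at y_v in a field with a positivity predicate *)

Section Localization.
Variables (n : nat) (F : fieldType) (pos : F -> Prop) (y : 'I_n -> F).
Implicit Types (v w : 'S_n) (i j : 'I_n).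

Hypothesis pos_neq0 : forall x, pos x -> x != 0.
Hypothesis pos1 : pos 1.
Hypothesis posD : forall x z, pos x -> pos z -> pos (x + z).
Hypothesis posM : forall x z, pos x -> pos z -> pos (x * z).
Hypothesis posV : forall x, pos x -> pos x^-1.
Hypothesis pos_y : forall i, pos (y i).
Hypothesis pos_yB : forall i j, (i < j)%N -> pos (y j - y i).

Lemma yB_neq0 i j : i != j -> y i - y j != 0.
Proof.
rewrite neq_ltn => /orP[/pos_yB/pos_neq0|/pos_yB/pos_neq0 //].
by rewrite -opprB oppr_eq0.
Qed.

Lemma perm_adjacent_neq v i j : j = i.+1 :> nat -> v i != v j.
Proof.
by move=> ij; rewrite (inj_eq perm_inj) -(inj_eq val_inj) /= ij neq_ltn ltnSn.
Qed.

Definition schubert_at w v : F :=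
  eval2 (fun i => y (v i)) y (double_schubert w).

Definition grothendieck_at w v : F :=
  laurent_eval (fun i => y (v i)) y (double_grothendieck w).

Lemma schubert_at_descent w v i j : j = i.+1 :> nat -> (w j < w i)%N ->
  (y (v i) - y (v j)) * schubert_at (tperm i j * w)%g v =
  schubert_at w v - schubert_at w (tperm i j * v)%g.
Proof.
move=> ij wji; rewrite /schubert_at -!(eval2_x (fun i => y (v i)) y) -eval2B.
rewrite -eval2M double_schubert_descent // eval2B; congr (_ - _).
by apply: eval2_swapx => k; rewrite permM.
Qed.

Lemma grothendieck_at_descent w v i j : j = i.+1 :> nat -> (w j < w i)%N ->
  (y (v i) - y (v j)) * grothendieck_at (tperm i j * w)%g v =
  y (v i) * grothendieck_at w v - y (v j) * grothendieck_at w (tperm i j * v)%g.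
Proof.
move=> ij wji; have vij := perm_adjacent_neq v ij.
rewrite /grothendieck_at double_grothendieck_descent //.
rewrite laurent_eval_demazure; first last.
- by rewrite -subr_eq0 yB_neq0.
- exact/pos_neq0/pos_y.
- exact/pos_neq0/pos_y.
rewrite mulrC divfK ?yB_neq0 // /laurent_eval; congr (_ - _ * _).
by apply: eval2_swapx => k; rewrite permM.
Qed.

Lemma schubert_at_longest v : schubert_at (longest_perm n) v =
  \prod_(i < n) \prod_(j < n | (i.+1 + j.+1 <= n)%N) (y (v i) - y j).
Proof.
rewrite /schubert_at; have [-> _] := double_schubertP n.
rewrite eval2_prod; apply: eq_bigr => i _.
by rewrite eval2_prod; apply: eq_bigr => j _; rewrite eval2B eval2_x eval2_y.
Qed.

Lemma grothendieck_at_longest v : grothendieck_at (longest_perm n) v =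
  \prod_(i < n) \prod_(j < n | (i.+1 + j.+1 <= n)%N) (1 - y j / y (v i)).
Proof.
rewrite /grothendieck_at double_grothendieck_longest /laurent_eval.
rewrite eval2_prod; apply: eq_bigr => i _.
rewrite eval2_prod; apply: eq_bigr => j _.
by rewrite eval2B eval2M eval2_1 eval2_x eval2_y.
Qed.

Lemma longest_prod_eq0 (f : 'I_n -> 'I_n -> F) v : (forall i, f i i = 0) ->
  v != longest_perm n ->
  \prod_(i < n) \prod_(j < n | (i.+1 + j.+1 <= n)%N) f (v i) j = 0.
Proof.
move=> f0 /not_longest[i vi].
by rewrite (bigD1 i) //= (bigD1 (v i)) //= f0 !mul0r.
Qed.

Lemma longest_prod_pos (f : 'I_n -> 'I_n -> F) :
  (forall i j, (j < i)%N -> pos (f i j)) ->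
  pos (\prod_(i < n) \prod_(j < n | (i.+1 + j.+1 <= n)%N)
         f (longest_perm n i) j).
Proof.
move=> f_pos; apply: big_ind => // i _; apply: big_ind => // j ij.
(* With indices from 1, i + j <= n says j < w_0(i). *)
by apply: f_pos; rewrite permE /=; lia.
Qed.

Lemma pos_divB i j : (i < j)%N -> pos (1 - y i / y j).
Proof.
move=> ij; rewrite -[1](divff (pos_neq0 (pos_y j))) -mulrBl.
by apply: posM; [apply: pos_yB | apply: posV].
Qed.

Lemma bruhat_le_schubert w v : bruhat_le w v = (schubert_at w v != 0).
Proof.
apply: (bruhat_le_recursion pos_neq0 posD posM posV) => {w v} [v||w v i j].
- rewrite schubert_at_longest.
  by apply: (@longest_prod_eq0 (fun a b => y a - y b)) => i; rewrite subrr.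
- rewrite schubert_at_longest.
  by apply: (@longest_prod_pos (fun a b => y a - y b)) => i j /pos_yB.
move=> ij wji vji; have vij := perm_adjacent_neq v ij.
have e := schubert_at_descent v ij wji.
have e' := schubert_at_descent (tperm i j * v)%g ij wji.
rewrite !permM tpermL tpermR mulgA tperm2 mul1g in e'.
(* Passing from v to v s_i changes the sign of both y_v(i) - y_v(j) and the right-hand side of [e],
   so the quotient is unchanged. *)
have sym : schubert_at (tperm i j * w)%g v =
           schubert_at (tperm i j * w)%g (tperm i j * v)%g.
  apply: (mulfI (yB_neq0 vij)); rewrite e.
  by rewrite -[y (v i) - _]opprB mulNr e' opprB.
split=> //; exists 1, (y (v i) - y (v j)); split=> //; first exact: pos_yB.
by rewrite -sym e mul1r addrC subrK.
Qed.

Lemma bruhat_le_grothendieck w v : bruhat_le w v = (grothendieck_at w v != 0).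
Proof.
apply: (bruhat_le_recursion pos_neq0 posD posM posV) => {w v} [v||w v i j].
- rewrite grothendieck_at_longest.
  apply: (@longest_prod_eq0 (fun a b => 1 - y b / y a)) => i.
  by rewrite divff ?subrr // pos_neq0.
- rewrite grothendieck_at_longest.
  apply: (@longest_prod_pos (fun a b => 1 - y b / y a)) => i j.
  exact: pos_divB.
move=> ij wji vji; have vij := perm_adjacent_neq v ij.
have e := grothendieck_at_descent v ij wji.
have e' := grothendieck_at_descent (tperm i j * v)%g ij wji.
rewrite !permM tpermL tpermR mulgA tperm2 mul1g in e'.
have sym : grothendieck_at (tperm i j * w)%g v =
           grothendieck_at (tperm i j * w)%g (tperm i j * v)%g.
  apply: (mulfI (yB_neq0 vij)); rewrite e.
  by rewrite -[y (v i) - _]opprB mulNr e' opprB.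
(* Dividing [e] by y_v(i) and solving for A(w, v) gives these coefficients. *)
split=> //; exists (y (v j) / y (v i)), (1 - y (v j) / y (v i)).
split; [by apply: posM => //; apply: posV | exact: pos_divB |].
have yi := pos_neq0 (pos_y (v i)).
have -> : 1 - y (v j) / y (v i) = (y (v i) - y (v j)) / y (v i).
  by rewrite mulrBl divff.
by rewrite -sym [X in _ + X]mulrAC e; field.
Qed.

End Localization.

(** * A positivity predicate on the fractions of Z[y_1, ..., y_n] *)

Section PositiveFractions.
Variable n : nat.
Local Notation Q := {mpoly int[n]}.

(* Evaluation at the increasing positive integers 1, ..., n stands for an
   order: a fraction is positive when it has a numerator and a denominator
   with positive values there. *)
Definition at_positive (f : Q) : bool := 0 < f.@[fun i : 'I_n => i.+1%:R].

Definition frac_pos (x : {fraction Q}) : Prop :=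
  exists f g, [/\ at_positive f, at_positive g & x = f%:F / g%:F].

Lemma at_positive_neq0 f : at_positive f -> f%:F != 0.
Proof.
by rewrite tofrac_eq0 /at_positive; case: eqP => // ->; rewrite meval0.
Qed.

Lemma at_positiveD f g : at_positive f -> at_positive g -> at_positive (f + g).
Proof. by rewrite /at_positive mevalD; apply: Num.Theory.addr_gt0. Qed.

Lemma at_positiveM f g : at_positive f -> at_positive g -> at_positive (f * g).
Proof. by rewrite /at_positive mevalM; apply: Num.Theory.mulr_gt0. Qed.

Lemma frac_pos_tofrac f : at_positive f -> frac_pos f%:F.
Proof.
move=> pf; exists f, 1; split=> //; first by rewrite /at_positive meval1.
by rewrite rmorph1 divr1.
Qed.

Lemma frac_pos_neq0 x : frac_pos x -> x != 0.
Proof.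
move=> [f [g [/at_positive_neq0 f0 /at_positive_neq0 g0 ->]]].
exact: mulf_neq0 f0 (invr_neq0 g0).
Qed.

Lemma frac_posD x z : frac_pos x -> frac_pos z -> frac_pos (x + z).
Proof.
move=> [f [g [pf pg ->]]] [h [k [ph pk ->]]].
exists (f * k + h * g), (g * k); split; last first.
- by rewrite addf_div ?at_positive_neq0 // tofracD !tofracM.
- exact: at_positiveM.
- by apply: at_positiveD; apply: at_positiveM.
Qed.

Lemma frac_posM x z : frac_pos x -> frac_pos z -> frac_pos (x * z).
Proof.
move=> [f [g [pf pg ->]]] [h [k [ph pk ->]]].
exists (f * h), (g * k); split; try exact: at_positiveM.
by rewrite mulf_div !tofracM.
Qed.

Lemma frac_posV x : frac_pos x -> frac_pos x^-1.
Proof. by move=> [f [g [pf pg ->]]]; exists g, f; rewrite invf_div. Qed.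

(** The value i + 1 is positive even for the first variable, whose index is 0. *)
Lemma frac_pos_var (i : 'I_n) : frac_pos ('X_i : Q)%:F.
Proof. by apply: frac_pos_tofrac; rewrite /at_positive mevalXU. Qed.

Lemma frac_pos_varB (i j : 'I_n) :
  (i < j)%N -> frac_pos (('X_j : Q)%:F - ('X_i : Q)%:F).
Proof.
move=> ij; rewrite -rmorphB; apply: frac_pos_tofrac.
rewrite /at_positive mevalB !mevalXU; lia.
Qed.

End PositiveFractions.

(** * Specialization to the variables and the equivalence *)

(** Links the Schubert value in the polynomial ring with the fraction field, where positivity is
    available. *)
Lemma tofrac_eval2 (n m : nat) (u z : 'I_n -> {mpoly int[m]})
    (f : {mpoly int[n + n]}) :
  (eval2 u z f)%:F = eval2 (fun i => (u i)%:F) (fun j => (z j)%:F) f.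
Proof.
rewrite /eval2 /mmap rmorph_sum; apply: eq_bigr => k _ /=.
rewrite rmorphM /= rmorph_int; congr (_ * _).
rewrite /mmap1 rmorph_prod; apply: eq_bigr => c _; rewrite rmorphXn /=.
by case: (split c).
Qed.

Theorem corollary3 (n : nat) (v w : 'S_n) :
  [<-> bruhat_le w v;
       eval2 (fun i => 'X_(v i)) (fun j => 'X_j) (double_schubert w)
         != 0 :> {mpoly int[n]};
       laurent_eval (fun i => ('X_(v i) : {mpoly int[n]})%:F)
                    (fun j => ('X_j : {mpoly int[n]})%:F)
                    (double_grothendieck w)
         != 0 :> {fraction {mpoly int[n]}}].
Proof.
have pos1 : frac_pos (1 : {fraction {mpoly int[n]}}).
  by rewrite -tofrac1; apply: frac_pos_tofrac; rewrite /at_positive meval1.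
have S := bruhat_le_schubert (@frac_pos_neq0 n) pos1 (@frac_posD n)
  (@frac_posM n) (@frac_posV n) (@frac_pos_varB n) w v.
have G := bruhat_le_grothendieck (@frac_pos_neq0 n) pos1 (@frac_posD n)
  (@frac_posM n) (@frac_posV n) (@frac_pos_var n) (@frac_pos_varB n) w v.
(* The embedding into fractions is injective, so nonvanishing returns to the polynomial ring. *)
rewrite /schubert_at -tofrac_eval2 tofrac_eq0 in S.
rewrite /grothendieck_at in G.
by tfae; rewrite -?S -?G.
Qed.
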